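(* Let $n\ge 4$ and let $H_{n+1}\cong K_n\cup K_1$ be the unlabeled graph on $n+1$ vertices obtained from the complete graph $K_n$ by adding an isolated vertex. Then $H_{n+1}$ is not a Riordan graph.
   Context: Write $a\equiv b$ for congruence modulo $2$ and $[t^k]h$ for the coefficient of $t^k$ in a formal power series $h$. For $g,f\in\mathbb{Z}[[t]]$ (or $\mathbb{Z}_2[[t]]$) with $f(0)=0$ and $m\ge 1$, the Riordan graph $G_m(g,f)$ is the simple graph with vertex set $[m]=\{1,\dots,m\}$ in which, for $i>j\ge 1$, the vertices $i$ and $j$ are adjacent if and only if $[t^{i-2}]\,g f^{\,j-1}\equiv 1$ (with $f^0=1$). An unlabeled simple graph on $m$ vertices is called a Riordan graph if at least one of its labelings by $[m]$ is of the form $G_m(g,f)$, i.e. if it is isomorphic to some $G_m(g,f)$. *)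

(* Defs.v *)
From HB Require Import structures.
From mathcomp Require Import all_boot all_order all_algebra.

Set Implicit Arguments.
Unset Strict Implicit.
Unset Printing Implicit Defensive.

Import GRing.Theory.
Local Open Scope ring_scope.

(* A formal power series is its coefficient sequence: [h k] is [t^k]h. *)
Definition fps (R : pzRingType) := nat -> R.

Definition fps_one (R : pzRingType) : fps R := fun k => (k == 0)%:R.

Definition fps_mul (R : pzRingType) (a b : fps R) : fps R :=
  fun k => \sum_(i < k.+1) a i * b (k - i)%N.

Definition fps_exp (R : pzRingType) (a : fps R) (n : nat) : fps R :=
  iter n (fps_mul a) (fps_one R).

Record sgraph := SGraph {
  svertex :> finType;
  sedge : rel svertex;
  sedge_sym : symmetric sedge;
  sedge_irrefl : irreflexive sedge
}.

Definition sgraph_iso (G H : sgraph) : Prop :=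
  exists2 phi : G -> H, bijective phi &
    forall x y : G, sedge (phi x) (phi y) = sedge x y.

Section CompleteGraph.
Variable n : nat.

Definition complete_edge : rel 'I_n := fun i j => i != j.

Lemma complete_edge_sym : symmetric complete_edge.
Proof. by move=> i j; rewrite /complete_edge eq_sym. Qed.

Lemma complete_edge_irrefl : irreflexive complete_edge.
Proof. by move=> i; rewrite /complete_edge eqxx. Qed.

Definition complete_graph : sgraph :=
  SGraph complete_edge_sym complete_edge_irrefl.
End CompleteGraph.

Section DisjointUnion.
Variables G H : sgraph.

Definition union_edge : rel (G + H)%type := fun u v =>
  match u, v with
  | inl x, inl y => sedge x y
  | inr x, inr y => sedge x y
  | _, _ => false
  end.

Lemma union_edge_sym : symmetric union_edge.
Proof. by move=> [x|x] [y|y] //=; apply: sedge_sym. Qed.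

Lemma union_edge_irrefl : irreflexive union_edge.
Proof. by move=> [x|x] /=; apply: sedge_irrefl. Qed.

Definition disjoint_union : sgraph :=
  SGraph union_edge_sym union_edge_irrefl.
End DisjointUnion.

Section RiordanGraph.
Variables (m : nat) (g f : fps int).

(* The labels are [1 <= j < i]; in that range [i - 2] and [j - 1] are the
   true differences. *)
Definition riordan_adj (i j : nat) : bool :=
  (1 <= j < i)%N &&
    (fps_mul g (fps_exp f (j - 1)) (i - 2)%N == 1 %[mod 2])%Z.

(* The element [u] of ['I_m] stands for the vertex labelled [u.+1]. *)
Definition riordan_edge : rel 'I_m := fun u v =>
  riordan_adj u.+1 v.+1 || riordan_adj v.+1 u.+1.

Lemma riordan_edge_sym : symmetric riordan_edge.
Proof. by move=> u v; rewrite /riordan_edge orbC. Qed.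

Lemma riordan_edge_irrefl : irreflexive riordan_edge.
Proof. by move=> u; rewrite /riordan_edge /riordan_adj ltnn andbF. Qed.

Definition riordan_graph : sgraph :=
  SGraph riordan_edge_sym riordan_edge_irrefl.
End RiordanGraph.

(* Reducing coefficients modulo 2 does not change the graph, so series over
   Z/2 would give the same notion. *)
Definition is_riordan (G : sgraph) : Prop :=
  (0 < #|G|)%N /\
  exists g f : fps int, f 0%N = 0 /\ sgraph_iso G (riordan_graph #|G| g f).

(* Main.v *)
Require Import Defs.
From mathcomp Require Import all_boot all_order all_algebra.
From mathcomp Require Import zify.

Import GRing.Theory.
Local Open Scope ring_scope.

(** Number the vertices of a Riordan graph on [n + 1] vertices from [0], so
    that [v < u] are adjacent exactly when the coefficient of [t^(u - 1)] in
    [g f^v] is odd, and let [w] be the isolated vertex of a labeling of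
    K_n + K_1. Column [v] of the adjacency matrix is the series [g f^v] read
    modulo [t^n], and two features of these columns exclude every position
    of [w].

    - Column [w] vanishes below the diagonal because [w] is isolated, and above
      it because [f(0) = 0]; so [g f^w = 0] modulo [t^n] and modulo 2. Every
      later column is a multiple of that one, hence vanishes too
      ([zero_column_propagates]). If [w <= n - 2], this contradicts the edge
      between the last two vertices.
    - The entry joining [v] to [v + 1] is [g_0 f_1^v] ([subdiagonal_coef]). If
      [w >= n - 1 >= 3], the edge between vertices 1 and 2 makes [g_0] and
      [f_1] odd, so [w - 1] and [w] are adjacent, which is absurd.

    Only finitely many coefficients matter, so the columns are computed with
    polynomials over the field with two elements, where the condition
    [f(0) = 0] reads [f = 'X * q]. *)

Section Columns.
Variable R : idomainType.
Implicit Types p q f : {poly R}.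

Lemma column_low_coef p q v k :
  (k < v)%N -> (p * ('X * q) ^+ v)`_k = 0.
Proof. by move=> ltkv; rewrite exprMn mulrCA coefXnM ltkv. Qed.

Lemma subdiagonal_coef p q v :
  (p * ('X * q) ^+ v)`_v = p`_0 * q`_0 ^+ v.
Proof.
by rewrite exprMn mulrCA coefXnM ltnn subnn -!horner_coef0 hornerM horner_exp.
Qed.

(** [p * f ^+ v] is a multiple of [p * f ^+ w], and the polynomials vanishing
    modulo ['X^n] form an ideal. *)
Lemma zero_column_propagates p f w v n :
  (w <= v)%N -> (forall k, (k < n)%N -> (p * f ^+ w)`_k = 0) ->
  forall k, (k < n)%N -> (p * f ^+ v)`_k = 0.
Proof.
move=> lewv col0 k ltkn; rewrite -(subnKC lewv) exprD mulrA coefM big1 //.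
by move=> [i lti] _ /=; rewrite col0 ?mul0r //; apply: leq_ltn_trans ltkn.
Qed.

(** Nonzero entries below the diagonal play the role of edges; over any integral
    domain, products of nonzero coefficients being nonzero is all that the
    subdiagonal argument requires. *)
Lemma no_clique_with_isolated_vertex p q (n w : nat) :
    (4 <= n)%N -> (w <= n)%N ->
    (forall u v, (v < u <= n)%N ->
       ((p * ('X * q) ^+ v)`_u.-1 != 0) = (u != w) && (v != w)) ->
  False.
Proof.
move=> len4 lewn entry.
have [lew | ltw] := leqP w.+2 n.
  have col0 k : (k < n)%N -> (p * ('X * q) ^+ w)`_k = 0.
    move=> ltkn; have [/column_low_coef -> // | lewk] := ltnP k w.
    apply/eqP/negbNE; rewrite -[k]/(k.+1.-1) entry ?eqxx ?andbF //.
    by rewrite ltnS lewk.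
  (* Vertices [n - 1] and [n] are both different from [w], hence adjacent. *)
  have := entry n n.-1; rewrite (@zero_column_propagates _ _ w _ n) //; try lia.
  by rewrite eqxx; lia.
(* Here [3 <= w], so vertices 1 and 2 lie in the clique. *)
have := entry 2 1; rewrite /= subdiagonal_coef expr1 mulf_eq0 negb_or.
have -> : (2 != w) && (1 != w) by lia.
case/(_ _)/andP=> [|p0 q0]; first by lia.
have := entry w w.-1; rewrite subdiagonal_coef mulf_eq0 negb_or p0 expf_neq0 //.
by rewrite eqxx; lia.
Qed.

End Columns.

Definition trunc2 (N : nat) (a : fps int) : {poly 'F_2} :=
  \poly_(i < N) (a i)%:~R.

Lemma coef_trunc2 N a k : (k < N)%N -> (trunc2 N a)`_k = (a k)%:~R.
Proof. by move=> ltkN; rewrite coef_poly ltkN. Qed.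

(** A coefficient of a product depends only on coefficients of the same or
    lower index, so truncated representatives suffice. *)
Lemma coef_mul_reduction N (a b : fps int) (p q : {poly 'F_2}) :
    (forall k, (k < N)%N -> p`_k = (a k)%:~R) ->
    (forall k, (k < N)%N -> q`_k = (b k)%:~R) ->
  forall k, (k < N)%N -> (p * q)`_k = (fps_mul a b k)%:~R.
Proof.
move=> pa qb k ltkN; rewrite coefM rmorph_sum; apply: eq_bigr => -[i lti] _ /=.
by rewrite rmorphM pa ?qb //; lia.
Qed.

Lemma coef_column_reduction N (g f : fps int) v k : (k < N)%N ->
  (trunc2 N g * trunc2 N f ^+ v)`_k = (fps_mul g (fps_exp f v) k)%:~R.
Proof.
apply: coef_mul_reduction k => [k|]; first exact: coef_trunc2.
elim: v => [|v IHv] k ltkN.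
  by rewrite expr0 coef1 /fps_exp /= /fps_one; case: (k == 0)%N.
rewrite exprS; apply: coef_mul_reduction ltkN => // j; exact: coef_trunc2.
Qed.

Lemma trunc2_eqXM N (f : fps int) :
  f 0%N = 0 -> trunc2 N f = 'X * \poly_(i < N.-1) (f i.+1)%:~R.
Proof.
move=> f0; apply/polyP => -[|k]; rewrite coefXM coef_poly /=.
  by rewrite f0; case: ifP.
by rewrite coef_poly; case: N => [|N].
Qed.

Lemma eqz_mod2_F2 (x : int) : (x == 1 %[mod 2])%Z = (x%:~R != 0 :> 'F_2).
Proof.
have dvd2 (y : int) : (2 %| y)%Z = (y%:~R == 0 :> 'F_2).
  by rewrite (dvdz_pcharf (pchar_Fp (isT : prime 2))).
by rewrite eqz_mod_dvd -dvd2; lia.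
Qed.

Lemma riordan_edge_lt m (g f : fps int) (u v : 'I_m) : (v < u)%N ->
  riordan_edge g f u v =
    ((trunc2 m g * trunc2 m f ^+ v)`_u.-1 != 0).
Proof.
move=> ltvu; rewrite coef_column_reduction; last first.
  by apply: leq_ltn_trans (ltn_ord u); apply: leq_pred.
rewrite -eqz_mod2_F2 /riordan_edge /riordan_adj /= !ltnS ltvu.
by rewrite ltnNge (ltnW ltvu) orbF !subn1 subn2.
Qed.

Lemma clique_plus_point_edge n (x y : disjoint_union (complete_graph n)
                                                     (complete_graph 1)) :
  sedge x y = [&& x != y, x != inr ord0 & y != inr ord0].
Proof.
case: x y => [x|x] [y|y]; rewrite ?[x]ord1 ?[y]ord1 ?eqxx ?andbF //=.
by rewrite andbT.
Qed.

Local Close Scope ring_scope.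

Theorem proposition2p13 (n : nat) (hn : 4 <= n) :
  ~ is_riordan (disjoint_union (complete_graph n) (complete_graph 1)).
Proof.
case=> _ [g [f [f0 [phi bij_phi phi_edge]]]].
have cardG : #|disjoint_union (complete_graph n) (complete_graph 1)| = n.+1.
  by rewrite card_sum !card_ord addn1.
move: phi bij_phi phi_edge; rewrite cardG => phi bij_phi phi_edge.
pose w : 'I_n.+1 := phi (inr ord0).
have edgeE (a b : 'I_n.+1) :
    riordan_edge g f a b = [&& a != b, a != w & b != w].
  have [psi phiK psiK] := bij_phi.
  have inj_phi := bij_inj bij_phi.
  rewrite -[a]psiK -[b]psiK [LHS]phi_edge clique_plus_point_edge.
  by rewrite /w !(inj_eq inj_phi).
apply: (@no_clique_with_isolated_vertex _ (trunc2 n.+1 g)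
          (\poly_(i < n) (f i.+1)%:~R)%R n w hn).
  by rewrite -ltnS ltn_ord.
move=> u v /andP[ltvu leun].
have ltvn : (v < n.+1)%N by apply: ltn_trans ltvu _.
have := riordan_edge_lt _ g f (Ordinal (leun : (u < n.+1)%N)) (Ordinal ltvn) ltvu.
rewrite /= (trunc2_eqXM _ _ f0) => <-.
by rewrite edgeE -!val_eqE /= (gtn_eqF ltvu).
Qed.
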